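(* Let $G=C_2\wr S_n$ and let $H$ be a subgroup of $G$ conjugate to $H_0$, where $H_0=\{[1,1,\dots,1;\sigma],\,[-1,-1,\dots,-1;\rho]\mid \sigma,\rho\in S_n\}$. Let $X_1$ and $X_2$ be the conjugacy classes of $G$ corresponding to the signed partitions $(n)$ and $(\bar n)$ respectively. (i) If $n$ is even, then $r\cdot G=H(X_1\cup X_2)$, where $r=2(n-1)!$. (ii) If $n$ is odd, then $r\cdot G=HX_1$ and $r\cdot G=HX_2$, where $r=(n-1)!$.
   Context: $C_2=\{\pm1\}$, and $C_2\wr S_n=C_2^n\rtimes S_n$ (the finite Coxeter group of type $B_n$, equivalently $C_n$) consists of the elements $[a_1,\dots,a_n;\sigma]$ with $a_i\in\{\pm1\}$, $\sigma\in S_n$, with multiplication $$[a_1,\dots,a_n;\sigma]\cdot[b_1,\dots,b_n;\tau]=[a_1b_{\sigma(1)},\dots,a_nb_{\sigma(n)};\sigma\tau],$$ where products in $S_n$ are taken from left to right, i.e. $(\sigma\tau)(i)=\tau(\sigma(i))$. Conjugacy classes of $C_2\wr S_n$ are indexed by signed partitions of $n$: each cycle $(k_1,\dots,k_m)$ of $\sigma$ contributes the part $m$ if $\prod_i a_{k_i}=1$ and the part $\bar m$ if $\prod_i a_{k_i}=-1$. In particular, the class of signed partition $(n)$ (resp. $(\bar n)$) is the set of all $[b_1,\dots,b_n;\tau]$ with $\tau$ an $n$-cycle and $\prod_i b_i=1$ (resp. $\prod_i b_i=-1$). For a finite group $G$, subsets $A,B\subseteq G$ and a positive integer $r$, the notation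 $r\cdot G=AB$ means that for every $g\in G$ there are exactly $r$ pairs $(a,b)\in A\times B$ with $ab=g$. *)

(* Defs.v *)
From HB Require Import structures.
From mathcomp Require Import all_boot all_fingroup all_solvable.

Set Implicit Arguments.
Unset Strict Implicit.
Unset Printing Implicit Defensive.

Import GroupScope.

(* C_2 = {+1, -1} is the group structure of mathcomp.solvable.alt on bool:
   b stands for (-1)^b, so that false is +1 (the unit), true is -1, and the
   product is addb.                                                          *)

Record wreathC2 (n : nat) : predArgType := WreathC2 {
  wsign : {ffun 'I_n -> bool};
  wperm : 'S_n
}.

Section WreathC2.

Variable n : nat.
Implicit Types g h k : wreathC2 n.

Definition pair_of_wreathC2 g := (wsign g, wperm g).
Definition wreathC2_of_pair (p : {ffun 'I_n -> bool} * 'S_n) :=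
  WreathC2 p.1 p.2.

Lemma pair_of_wreathC2K : cancel pair_of_wreathC2 wreathC2_of_pair.
Proof. by case. Qed.

HB.instance Definition _ :=
  Finite.copy (wreathC2 n) (can_type pair_of_wreathC2K).

(* In 'S_n, (s * t) i = t (s i). *)
Definition wreathC2_mul g h :=
  WreathC2 [ffun i => wsign g i * wsign h (wperm g i)] (wperm g * wperm h).

Definition wreathC2_one := WreathC2 [ffun=> 1] (1 : 'S_n).

Definition wreathC2_inv g :=
  WreathC2 [ffun i => (wsign g ((wperm g)^-1 i))^-1] (wperm g)^-1.

Lemma wreathC2_mulA : associative wreathC2_mul.
Proof.
move=> g h k; rewrite /wreathC2_mul /= mulgA; congr WreathC2.
by apply/ffunP=> i; rewrite !ffunE permM mulgA.
Qed.

Lemma wreathC2_mul1 : left_id wreathC2_one wreathC2_mul.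
Proof.
case=> a s; rewrite /wreathC2_mul /= mul1g; congr WreathC2.
by apply/ffunP=> i; rewrite !ffunE perm1 mul1g.
Qed.

Lemma wreathC2_mulV : left_inverse wreathC2_one wreathC2_inv wreathC2_mul.
Proof.
case=> a s; rewrite /wreathC2_mul /= mulVg; congr WreathC2.
by apply/ffunP=> i; rewrite !ffunE mulVg.
Qed.

HB.instance Definition _ := Finite_isGroup.Build (wreathC2 n)
  wreathC2_mulA wreathC2_mul1 wreathC2_mulV.

(* A signed partition is a list of pairs (m, b), up to reordering: (m, false)
   is the part m and (m, true) is the part m-bar. Fixed points of wperm g are
   cycles of length 1.                                                       *)
Definition signed_cycle_type g : seq (nat * bool) :=
  [seq (#|c|, \prod_(i in c) wsign g i)
     | c : {set 'I_n} in porbits (wperm g)].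

Definition is_class_of_type (la : seq (nat * bool))
    (X : {set wreathC2 n}) : Prop :=
  X \in classes [set: wreathC2 n]
  /\ {in X, forall g, perm_eq (signed_cycle_type g) la}.

Definition constant_sign_set : {set wreathC2 n} :=
  [set WreathC2 [ffun=> false] s | s : 'S_n]
  :|: [set WreathC2 [ffun=> true] s | s : 'S_n].

Lemma mem_constant_sign_set g :
  reflect (exists b, wsign g = [ffun=> b]) (g \in constant_sign_set).
Proof.
apply: (iffP setUP) => [[] /imsetP[s _ ->] | [b]].
- by exists false.
- by exists true.
by case: g b => a s [] /= ->; [right | left]; apply: imset_f.
Qed.

Lemma constant_sign_group_set : group_set constant_sign_set.
Proof.
apply/group_setP; split=> [|g h /mem_constant_sign_set[b gb]].
  by apply/mem_constant_sign_set; exists false; apply/ffunP=> i; rewrite !ffunE.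
move=> /mem_constant_sign_set[c hc]; apply/mem_constant_sign_set.
by exists (b * c); apply/ffunP=> i; rewrite !ffunE gb hc !ffunE.
Qed.

Canonical constant_sign_group := Group constant_sign_group_set.

End WreathC2.

(* r . G = A B, where G is the whole group gT. *)
Definition uniform_factorization (gT : finGroupType) (r : nat)
    (A B : {set gT}) : Prop :=
  forall g : gT,
    #|[set p : gT * gT | [&& p.1 \in A, p.2 \in B & p.1 * p.2 == g]]| = r.

(* Main.v *)
Require Import Defs.
From mathcomp Require Import all_boot all_fingroup all_solvable.

Set Implicit Arguments.
Unset Strict Implicit.
Unset Printing Implicit Defensive.

(** Conjugating H, X1 and X2 simultaneously does not change the number of ways
to factor an element, and conjugacy classes are invariant under conjugation,
so one may take H = H0 ([uniform_factorizationJ]).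

A factorization g = h * k with h in H0 amounts to a common sign b and a
permutation rho, namely h = [b, ..., b; rho], with k = h^-1 * g.  Write
g = [a; sigma].  The permutation of k is rho^-1 * sigma, which takes every
value once as rho varies; hence (n-1)! choices of rho make it an n-cycle.  The
product of the signs is a homomorphism from G to C_2, so for k it is b^n times
the product of a.  If n is odd, exactly one b gives it a prescribed value.  If
n is even it does not depend on b, so that a single class would receive either
both choices of b or none; the union of X1 and X2 accepts both values of the
product, hence always both choices of b, and this is the factor 2.  The count
is [card_constant_sign_factorizations].

It remains to see that X1 and X2 consist of all the elements whose permutation
is an n-cycle and whose sign product is prescribed ([is_class_of_typeE]).
Every such element is conjugate to a normal form, the rotation i |-> i + 1 of
'I_n with its whole sign product placed at the last point
([conj_signed_rotation]).  The same rotation serves to count the n-cycles: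
each of them is its conjugate by exactly one permutation fixing 0
([full_cycleP], [card_full_cycle]). *)

(** * Permutations with a single cycle *)

Section Cycles.
Variable n : nat.
Implicit Types (s t p : 'S_n.+1) (g h : wreathC2 n.+1).

Definition full_cycle s := porbit s ord0 == [set: 'I_n.+1].

Definition rotation : 'S_n.+1 := perm (@ordS_inj n.+1).

Lemma iter_rotation k : (iter k rotation ord0 : nat) = k %% n.+1.
Proof.
elim: k => [|k IHk] /=; first by rewrite mod0n.
by rewrite permE /= IHk -(addn1 (_ %% _)) modnDml addn1.
Qed.

Lemma iter_rotation_ord (i : 'I_n.+1) : iter i rotation ord0 = i.
Proof. by apply/val_inj; rewrite /= iter_rotation modn_small. Qed.

Lemma iter_conjg s p k x : iter k (s ^ p)%g (p x) = p (iter k s x).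
Proof. by elim: k => //= k ->; rewrite permJ. Qed.

(** The conjugating permutation lists the cycle from 0: it sends i to the
i-th iterate of 0 under [s], so the rotation of indices becomes [s]. *)
Lemma full_cycleP s :
  reflect (exists2 p : 'S_n.+1, p ord0 = ord0 & s = (rotation ^ p)%g)
          (full_cycle s).
Proof.
apply: (iffP eqP) => [s_full | [p p0 ->]]; last first.
  apply/setP=> x; rewrite in_setT; apply/porbitP.
  exists (p^-1%g x : 'I_n.+1).
  by rewrite permX -p0 iter_conjg iter_rotation_ord permKV.
have orb_card : #|porbit s ord0| = n.+1 by rewrite s_full cardsT card_ord.
have inj_p : injective (fun i : 'I_n.+1 => iter i s ord0).
  move=> i j eq_ij; apply/val_inj/eqP.
  have := uniq_traject_porbit s ord0; rewrite orb_card => Us.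
  rewrite -(nth_uniq ord0 _ _ Us) ?size_traject ?ltn_ord //.
  by rewrite !nth_traject ?ltn_ord //; apply/eqP.
exists (perm inj_p); first by rewrite permE.
apply/permP=> x; rewrite -[x](permKV (perm inj_p)).
set i := (perm inj_p)^-1%g x; rewrite permJ !permE /= -iterS.
(* The last index wraps around, just as the cycle closes up at 0. *)
have [lt_i | le_i] := ltnP i.+1 n.+1; first by rewrite modn_small.
have -> : i.+1 = n.+1 by apply/eqP; rewrite eqn_leq le_i ltn_ord.
by rewrite modnn; have:= iter_porbit s ord0; rewrite orb_card.
Qed.

(** A conjugate of the rotation by a permutation [p] fixing 0 determines [p],
since its i-th iterate at 0 is [p i]; so the n.+1-cycles are in bijection with
the permutations of the nonzero points. *)
Lemma card_full_cycle : #|[set s | full_cycle s]| = n`!.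
Proof.
have fix0 p : (p \in perm_on [set~ ord0]) = (p ord0 == ord0).
  rewrite unfold_in; apply/subsetP/eqP=> [p_on | p0 x].
    by apply/eqP; apply/contraT => /p_on; rewrite !inE eqxx.
  by rewrite !inE; apply: contraNneq => ->; rewrite p0.
have -> : [set s | full_cycle s]
    = [set (rotation ^ p)%g | p in perm_on [set~ ord0]].
  apply/setP=> s; rewrite inE; apply/full_cycleP/imsetP => [] [p].
    by move=> p0 ->; exists p; rewrite ?fix0 ?p0.
  by rewrite fix0 => /eqP p0 ->; exists p.
rewrite card_in_imset ?card_perm ?cardsC1 ?card_ord // => p q.
rewrite !fix0 => /eqP p0 /eqP q0 eq_pq; apply/permP=> i.
by rewrite -[i]iter_rotation_ord -!iter_conjg p0 q0 eq_pq.
Qed.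

(** * Elements of the wreath product over a full cycle *)

(** In the additive encoding of C_2 on the booleans, products of signs become
parities, for which the commutative big operator theory applies. *)
Definition sign_product g : bool := \big[addb/false]_i wsign g i.

Lemma sign_productM g h :
  sign_product (g * h)%g = sign_product g (+) sign_product h.
Proof.
rewrite /sign_product [in X in _ (+) X](reindex_inj (@perm_inj _ (wperm g))).
by rewrite -big_split; apply: eq_bigr => i _; rewrite ffunE.
Qed.

Definition signed_rotation (b : bool) : wreathC2 n.+1 :=
  WreathC2 [ffun i => (i == ord_max) && b] rotation.

(** Once the cycle is listed from 0, the signs can be moved along it: the
conjugator multiplies up the signs met before each point.  The obstruction to
closing up is the total product, which is the sign left at the last point. *)
Lemma conj_signed_rotation g :
  full_cycle (wperm g) ->
  exists x, g = (signed_rotation (sign_product g) ^ x)%g.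
Proof.
case/full_cycleP=> p p0 Dg.
pose e (i : 'I_n.+1) := \big[addb/false]_(j < n.+1 | j < i) wsign g (p j).
pose x : wreathC2 n.+1 := WreathC2 (finfun e) p.
exists x; apply: (mulgI x); rewrite -conjgC.
case: g @e @x Dg => a s e x /= ->; congr WreathC2; last by rewrite /= -conjgC.
apply/ffunP=> i; rewrite !ffunE permE.
have eS : e i (+) a (p i) = \big[addb/false]_(j < n.+1 | j < i.+1) a (p j).
  rewrite [RHS](bigD1 i) //= addbC; congr addb.
  by apply: eq_bigl => j; rewrite ltnS ltn_neqAle andbC.
transitivity (e i (+) a (p i)); first by [].
rewrite eS; have [-> | neq_i] := eqVneq i ord_max.
  rewrite /e /= modnn big_pred0_eq /= [RHS]addbF.
  rewrite [RHS](reindex_inj (@perm_inj _ p)).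
  by apply: eq_bigl => j; rewrite ltn_ord.
rewrite /e /= modn_small //.
by move: neq_i; rewrite -val_eqE /= ltnS ltn_neqAle -ltnS ltn_ord andbT.
Qed.

(** A single part n.+1 forces a full cycle and fixes the sign product;
conversely the elements with these two properties share a normal form, so they
all lie in the class. *)
Lemma is_class_of_typeE b (X : {set wreathC2 n.+1}) :
  is_class_of_type [:: (n.+1, b)] X ->
  X = [set g | full_cycle (wperm g) & sign_product g == b].
Proof.
case=> /imsetP[x _ DX] typeX.
have sub g : g \in X -> full_cycle (wperm g) && (sign_product g == b).
  move=> /typeX type_g; move/perm_size: (type_g) => /=.
  rewrite size_map -cardE => /eqP/cards1P[c orb_c].
  move: type_g; rewrite /signed_cycle_type orb_c.
  rewrite /image_mem enum_set1 /= => /perm_mem/(_ (n.+1, b)).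
  rewrite !inE eqxx => /eqP[card_c prod_c].
  have c_full : c = setT.
    by apply/eqP; rewrite eqEcard subsetT cardsT card_ord -card_c leqnn.
  have : porbit (wperm g) ord0 \in porbits (wperm g) by apply: imset_f.
  rewrite orb_c inE c_full /full_cycle => -> /=.
  rewrite prod_c c_full; apply/eqP.
  by apply: eq_bigl => i; rewrite inE.
apply/setP=> g; rewrite inE; apply/idP/idP => [/sub // | g_full].
have Xx : x \in X by rewrite DX class_refl.
have /andP[/conj_signed_rotation[y Dx] /eqP xb] := sub x Xx.
case/andP: g_full => /conj_signed_rotation[z Dg] /eqP gb; move: Dx Dg.
rewrite xb gb => Dx Dg; rewrite DX; apply/imsetP; exists (y^-1 * z)%g => //.
by rewrite Dg Dx conjgM conjgK.
Qed.

(** * Counting factorizations *)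

(** The factorizations are parametrized by the common sign [b] of the left
factor and the permutation [t] of the right factor, which are constrained
independently: the sign product of the right factor does not involve [t].  The
predicate [D] treats the two classes and their union at once. *)
Lemma card_constant_sign_factorizations (D : pred bool) g :
  #|[set q : wreathC2 n.+1 * wreathC2 n.+1 |
      [&& q.1 \in constant_sign_group n.+1,
          q.2 \in [set h | full_cycle (wperm h) & D (sign_product h)]
        & (q.1 * q.2)%g == g]]|
  = #|[set b | D ((odd n.+1 && b) (+) sign_product g)]| * n`!.
Proof.
pose h (b : bool) t : wreathC2 n.+1 := WreathC2 [ffun=> b] (wperm g * t^-1)%g.
pose f (u : bool * 'S_n.+1) := (h u.1 u.2, (h u.1 u.2)^-1 * g)%g.
have inj_f : injective f.
  move=> [b s] [c t] [/ffunP/(_ ord0)]; rewrite !ffunE => ->.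
  by move/mulgI/invg_inj->.
have sign_h b t : sign_product (h b t) = odd n.+1 && b.
  rewrite /sign_product (eq_bigr (fun=> b)) => [|i _]; last by rewrite ffunE.
  rewrite big_const_ord; elim: (n.+1) => //= m ->.
  by case: b (odd m) => [] [].
have sign_hV b t :
    sign_product ((h b t)^-1 * g)%g = (odd n.+1 && b) (+) sign_product g.
  by rewrite -[in RHS](mulKVg (h b t) g) [in RHS]sign_productM sign_h addKb.
rewrite -card_full_cycle -cardsX -(card_imset _ inj_f); apply: eq_card => q.
rewrite inE; apply/and3P/imsetP => [[/mem_constant_sign_set[b q1b]] | ].
  rewrite inE => /andP[q2_full Dq2] /eqP Dg.
  have Dq1 : q.1 = h b (wperm q.2).
    by rewrite /h -Dg mulgK -q1b; case: (q.1).
  have Dq : q = f (b, wperm q.2).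
    by rewrite /f /= -Dq1 -Dg mulKg; case: (q).
  exists (b, wperm q.2) => //; rewrite !inE /= q2_full andbT.
  by rewrite -(sign_hV b (wperm q.2)) -Dq1 -Dg mulKg.
case=> [[b t] /setXP[]]; rewrite [_ \in _]inE => Db; rewrite inE => t_full ->.
split.
- by apply/mem_constant_sign_set; exists b.
- by rewrite inE sign_hV Db andbT /= invMg invgK mulgKV.
by rewrite mulKVg.
Qed.

End Cycles.

Lemma uniform_factorizationJ (gT : finGroupType) r (A B : {set gT}) (x : gT) :
  uniform_factorization r A B ->
  uniform_factorization r (A :^ x)%g (B :^ x)%g.
Proof.
move=> rAB g; rewrite -(rAB (g ^ x^-1)%g).
pose f (q : gT * gT) := (q.1 ^ x, q.2 ^ x)%g.
have inj_f : injective f by move=> [a b] [c d] [/conjg_inj-> /conjg_inj->].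
rewrite -[RHS](card_imset _ inj_f); apply: eq_card => q.
rewrite inE !mem_conjg; apply/and3P/imsetP => [[Aq Bq /eqP Dg] | [u]].
  exists (q.1 ^ x^-1, q.2 ^ x^-1)%g.
    by rewrite inE Aq Bq /= -Dg conjMg eqxx.
  by rewrite /f /= !conjgKV; case: (q).
rewrite inE => /and3P[Au Bu /eqP Dg] ->; rewrite /= !conjgK; split=> //.
by rewrite -conjMg Dg conjgKV.
Qed.

Theorem theorem4p2 (n : nat) (n_gt0 : 0 < n)
    (H : {group wreathC2 n})
    (H_conj : exists x : wreathC2 n, H :=: (constant_sign_group n :^ x)%g)
    (X1 X2 : {set wreathC2 n})
    (X1_class : is_class_of_type [:: (n, false)] X1)
    (X2_class : is_class_of_type [:: (n, true)] X2) :
  (~~ odd n -> uniform_factorization (2 * (n.-1)`!) H (X1 :|: X2))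
  /\ (odd n -> uniform_factorization (n.-1)`! H X1
               /\ uniform_factorization (n.-1)`! H X2).
Proof.
case: n n_gt0 H H_conj X1 X2 X1_class X2_class => // n _ H [x DH] X1 X2 X1t X2t.
have normal b X : is_class_of_type [:: (n.+1, b)] X -> (X :^ x)%g = X.
  case=> /imsetP[y _ ->] _; apply/normP.
  by apply: (subsetP (class_norm y _)); rewrite inE.
have conj r X : (X :^ x)%g = X ->
    uniform_factorization r (constant_sign_group n.+1) X ->
    uniform_factorization r H X.
  by move=> nX /(uniform_factorizationJ x); rewrite nX -DH.
have [X1x X2x] := (normal _ _ X1t, normal _ _ X2t).
have odd_case b X : odd n.+1 -> is_class_of_type [:: (n.+1, b)] X ->
    uniform_factorization n`! H X.
  move=> n_odd Xt; apply: conj (normal _ _ Xt) _ => g.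
  rewrite (is_class_of_typeE Xt).
  rewrite (card_constant_sign_factorizations (pred1 b)) n_odd.
  rewrite -[RHS]mul1n; congr muln; apply/eqP/cards1P.
  exists (b (+) sign_product g); apply/setP=> c; rewrite !inE /=.
  by case: b c (sign_product g) {Xt} => [] [] [].
split=> [n_even | n_odd]; last first.
  by split; [apply: odd_case X1t | apply: odd_case X2t].
apply: conj; first by rewrite conjUg X1x X2x.
move=> g.
have -> : X1 :|: X2 =
    [set h | full_cycle (wperm h) & predT (sign_product h)].
  rewrite (is_class_of_typeE X1t) (is_class_of_typeE X2t).
  by apply/setP=> h; rewrite !inE -andb_orr; case: (sign_product h).
rewrite card_constant_sign_factorizations; congr muln.
by rewrite -card_bool -cardsT; apply: eq_card => b; rewrite !inE.
Qed.
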